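(* Let $n,m,k$ be positive integers with $k\le m$, and let $\bar{\mathbf a}=(\bar{\mathbf a}^1,\dots,\bar{\mathbf a}^m)\in\mathbb R^{n\times m}$ be such that $\bar{\mathbf a}^1,\dots,\bar{\mathbf a}^m$ are pairwise distinct. Then the optimal value function $v:\mathbb R^{n\times m}\to\mathbb R$ defined in the context is locally Lipschitz at $\bar{\mathbf a}$, i.e., there exist $L_0>0$ and $\delta_0>0$ such that $$|v(\mathbf a)-v(\mathbf a')|\le L_0\|\mathbf a-\mathbf a'\|$$ for all $\mathbf a,\mathbf a'\in\mathbb R^{n\times m}$ satisfying $\|\mathbf a-\bar{\mathbf a}\|<\delta_0$ and $\|\mathbf a'-\bar{\mathbf a}\|<\delta_0$.
   Context: $\mathbb R^n$ carries the Euclidean norm. Elements of $\mathbb R^{n\times m}$ are written $\mathbf a=({\mathbf a}^1,\dots,{\mathbf a}^m)$ with ${\mathbf a}^i\in\mathbb R^n$, and $\mathbb R^{n\times m}$ is equipped with the sum norm $\|\mathbf a\|=\sum_{i=1}^m\|{\mathbf a}^i\|$. For $\mathbf a\in\mathbb R^{n\times m}$ and $\mathbf x=({\mathbf x}^1,\dots,{\mathbf x}^k)\in\mathbb R^{n\times k}$ put $$f(\mathbf x,\mathbf a)=\frac1m\sum_{i=1}^m\Big(\min_{j=1,\dots,k}\|{\mathbf a}^i-{\mathbf x}^j\|^2\Big).$$ The optimal value function is $v(\mathbf a)=\min\{f(\mathbf x,\mathbf a)\mid\mathbf x\in\mathbb R^{n\times k}\}$ (the minimum is attained for every $\mathbf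 a$). *)

(* Defs.v *)
From HB Require Import structures.
From mathcomp Require Import all_boot all_order all_algebra.
From mathcomp Require Import all_classical all_reals.
From mathcomp Require Import ring lra.

Set Implicit Arguments.
Unset Strict Implicit.
Unset Printing Implicit Defensive.

Import Order.TTheory GRing.Theory Num.Theory.
Local Open Scope classical_set_scope.
Local Open Scope ring_scope.

(* A family of m points of R^n is the matrix 'M[R]_(n, m) whose i-th column
   [col i a] is the i-th point. *)

(* MathComp-Analysis equips matrices with the sup norm, so the Euclidean norm
   and the sum of the Euclidean norms of the columns are defined here. *)
Definition enorm (R : realType) (n : nat) (u : 'cV[R]_n) : R :=
  Num.sqrt (\sum_(l < n) u l 0 ^+ 2).

Definition sum_norm (R : realType) (n m : nat) (a : 'M[R]_(n, m)) : R :=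
  \sum_(i < m) enorm (col i a).

(* The two minima below are written with the real [inf] of the set of values;
   [kmeans_min_attained] and [opt_value_attained] show that, for 0 < k, both
   are attained, i.e. are genuine minima. *)
Definition kmeans_obj (R : realType) (n m k : nat)
    (x : 'M[R]_(n, k)) (a : 'M[R]_(n, m)) : R :=
  m%:R^-1 * \sum_(i < m)
    inf [set enorm (col i a - col j x) ^+ 2 | j in [set: 'I_k]].

Definition opt_value (R : realType) (n m k : nat) (a : 'M[R]_(n, m)) : R :=
  inf [set kmeans_obj x a | x in [set: 'M[R]_(n, k)]].

Lemma inf_attained (R : realType) (T : Type) (F : T -> R) (t0 : T) :
  (forall t, F t0 <= F t) -> inf [set F t | t in [set: T]] = F t0.
Proof.
move=> Fmin; apply/eqP; rewrite eq_le; apply/andP; split.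
  apply: ge_inf; last by exists t0.
  by exists (F t0) => _ [t _ <-].
apply: lb_le_inf; first by exists (F t0), t0.
by move=> _ [t _ <-].
Qed.

Lemma kmeans_min_attained (R : realType) (n k : nat)
    (u : 'cV[R]_n) (x : 'M[R]_(n, k)) : (0 < k)%N ->
  exists j0 : 'I_k,
    inf [set enorm (u - col j x) ^+ 2 | j in [set: 'I_k]]
      = enorm (u - col j0 x) ^+ 2 /\
    (forall j : 'I_k, enorm (u - col j0 x) ^+ 2 <= enorm (u - col j x) ^+ 2).
Proof.
move=> k0; pose F (j : 'I_k) := enorm (u - col j x) ^+ 2.
have [j0 _ j0min] := arg_minP F (erefl (predT (Ordinal k0))).
have Fmin j : F j0 <= F j by exact: j0min.
by exists j0; split => //; apply: (inf_attained (F := F)).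
Qed.

Lemma sqr_enorm (R : realType) (n : nat) (u : 'cV[R]_n) :
  enorm u ^+ 2 = \sum_(l < n) u l 0 ^+ 2.
Proof. by rewrite sqr_sqrtr // sumr_ge0 // => l _; rewrite sqr_ge0. Qed.

Lemma mean_minimizes (R : realType) (I : finType) (P : pred I) (b : I -> R)
    (y : R) :
  \sum_(i | P i) (b i - #|P|%:R^-1 * \sum_(j | P j) b j) ^+ 2
    <= \sum_(i | P i) (b i - y) ^+ 2.
Proof.
have [P0|] := posnP #|P|.
  rewrite !big_pred0 //; apply: (card0_eq P0).
move=> cP; set c := #|P|%:R^-1 * _.
have c0 : #|P|%:R != 0 :> R by rewrite pnatr_eq0 -lt0n.
have dev0 : \sum_(i | P i) (b i - c) = 0.
  rewrite sumrB sumr_const -mulr_natl /c mulrA mulfV // mul1r.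
  by rewrite subrr.
have -> : \sum_(i | P i) (b i - y) ^+ 2 =
    \sum_(i | P i) ((b i - c) ^+ 2 + (b i - c) * (2 * (c - y)) + (c - y) ^+ 2).
  by apply: eq_bigr => i _; ring.
rewrite !big_split /= -mulr_suml dev0 mul0r addr0 lerDl.
by apply: sumr_ge0 => i _; rewrite sqr_ge0.
Qed.

Lemma opt_value_attained (R : realType) (n m k : nat) (a : 'M[R]_(n, m)) :
  (0 < k)%N ->
  exists x : 'M[R]_(n, k), opt_value k a = kmeans_obj x a /\
    (forall y : 'M[R]_(n, k), kmeans_obj x a <= kmeans_obj y a).
Proof.
move=> k0.
pose ctr (s : {ffun 'I_m -> 'I_k}) : 'M[R]_(n, k) :=
  \matrix_(l, j) (#|[pred i | s i == j]|%:R^-1 * \sum_(i | s i == j) a l i).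
pose G s := kmeans_obj (ctr s) a.
have [s0 _ s0min] := arg_minP G (erefl (predT [ffun=> Ordinal k0])).
suff H (y : 'M[R]_(n, k)) : kmeans_obj (ctr s0) a <= kmeans_obj y a.
  exists (ctr s0); split=> //.
  exact: (@inf_attained R _ (fun x : 'M[R]_(n, k) => kmeans_obj x a)).
have [s sP] : exists s : {ffun 'I_m -> 'I_k}, forall i,
    inf [set enorm (col i a - col j y) ^+ 2 | j in [set: 'I_k]]
      = enorm (col i a - col (s i) y) ^+ 2.
  have /choice[s sP] := fun i => kmeans_min_attained (col i a) y k0.
  by exists [ffun i => s i] => i; rewrite ffunE; case: (sP i).
apply: (le_trans (s0min s isT)).
rewrite /G /kmeans_obj ler_wpM2l ?invr_ge0 ?ler0n //.
rewrite [leRHS](eq_bigr _ (fun i _ => sP i)).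
apply: (@le_trans _ _ (\sum_i enorm (col i a - col (s i) (ctr s)) ^+ 2)).
  apply: ler_sum => i _.
  by have [j [-> jmin]] := kmeans_min_attained (col i a) (ctr s) k0.
rewrite (partition_big s predT) //= [leRHS](partition_big s predT) //=.
apply: ler_sum => j _.
rewrite (eq_bigr _ (fun i _ => sqr_enorm _)).
rewrite [leRHS](eq_bigr _ (fun i _ => sqr_enorm _)).
rewrite exchange_big [leRHS]exchange_big /=.
apply: ler_sum => l _.
have := mean_minimizes [pred i | s i == j] (a l) (y l j).
rewrite (eq_bigr (fun i => ((col i a - col (s i) (ctr s)) l 0) ^+ 2)).
  rewrite [X in _ <= X -> _](eq_bigr
    (fun i => ((col i a - col (s i) y) l 0) ^+ 2)) //.
  by move=> i /= /eqP <-; rewrite !mxE.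
by move=> i /= /eqP <-; rewrite !mxE.
Qed.

(* Main.v *)
Require Import Defs.
From mathcomp Require Import all_boot all_order all_algebra.
From mathcomp Require Import all_classical all_reals.
From mathcomp Require Import ring lra.

(** The optimal value [opt_value k a] is the minimum over the centers [x] of
    [kmeans_obj x a], so an increase of the optimal value from [a'] to [a] is
    at most the increase, for centers optimal for [a'], of the objective.  The
    centers range over an unbounded set, and instead of confining them it
    suffices to bound the distance [d_i] from each point of [a'] to its nearest
    optimal center: comparison with all centers at the origin gives
    [\sum_i d_i ^+ 2 <= \sum_i enorm (col i a') ^+ 2 <= sum_norm a' ^+ 2]
    ([optimal_dist_le]).

    By the triangle inequality ([enormD]), moving the data from [a'] to [a]
    changes [d_i] by at most [e_i = enorm (col i (a - a'))], hence raises
    [d_i ^+ 2] by at most [(2 * sum_norm a' + e_i) * e_i].  Averaging over [i]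
    gives [opt_value_sub_le], where the roles of [a] and [a'] can be exchanged.
    On the unit ball around [abar] the factor
    [2 * sum_norm a' + sum_norm (a - a')] is at most
    [2 * (sum_norm abar + 1) + 2], which serves as Lipschitz constant. *)

Import Order.TTheory GRing.Theory Num.Theory.
Local Open Scope ring_scope.

Lemma enorm_ge0 {R : realType} {n : nat} (u : 'cV[R]_n) : 0 <= enorm u.
Proof. exact: sqrtr_ge0. Qed.

Lemma enorm_eq0 {R : realType} {n : nat} (u : 'cV[R]_n) :
  enorm u = 0 -> u = 0.
Proof.
move=> u0; have := sqr_enorm u; rewrite u0 expr0n /= => /esym/eqP.
rewrite psumr_eq0 => [/allP h|l _]; last exact: sqr_ge0.
apply/colP => l; rewrite mxE; apply/eqP.
by rewrite -sqrf_eq0; apply: h; rewrite mem_index_enum.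
Qed.

Lemma enormN {R : realType} {n : nat} (u : 'cV[R]_n) : enorm (- u) = enorm u.
Proof.
by congr Num.sqrt; apply: eq_bigr => l _; rewrite mxE sqrrN.
Qed.

(** Cauchy-Schwarz: the squared norm of [enorm v *: u - enorm u *: v] is
    [2 * (enorm u * enorm v) * (enorm u * enorm v - \sum_l u l 0 * v l 0)]. *)
Lemma enorm_dot_le {R : realType} {n : nat} (u v : 'cV[R]_n) :
  \sum_(l < n) u l 0 * v l 0 <= enorm u * enorm v.
Proof.
have [/enorm_eq0 ->|u0] := eqVneq (enorm u) 0.
  rewrite big1 ?mulr_ge0 ?enorm_ge0 // => l _.
  by rewrite mxE mul0r.
have [/enorm_eq0 ->|v0] := eqVneq (enorm v) 0.
  rewrite big1 ?mulr_ge0 ?enorm_ge0 // => l _.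
  by rewrite mxE mulr0.
have uv0 : 0 < enorm u * enorm v.
  by rewrite mulr_gt0 // lt0r ?u0 ?v0 enorm_ge0.
have : 0 <= \sum_(l < n) (enorm v * u l 0 - enorm u * v l 0) ^+ 2.
  by apply: sumr_ge0 => l _; exact: sqr_ge0.
under eq_bigr => l _.
  have -> : (enorm v * u l 0 - enorm u * v l 0) ^+ 2 =
      enorm v ^+ 2 * u l 0 ^+ 2 + enorm u ^+ 2 * v l 0 ^+ 2
      - 2 * (enorm u * enorm v) * (u l 0 * v l 0) by ring.
  over.
rewrite sumrB big_split /= -!mulr_sumr -!sqr_enorm.
set s := \sum_l _; have -> : enorm v ^+ 2 * enorm u ^+ 2 +
    enorm u ^+ 2 * enorm v ^+ 2 - 2 * (enorm u * enorm v) * s =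
    (enorm u * enorm v) * (2 * (enorm u * enorm v - s)) by ring.
by rewrite pmulr_rge0 // pmulr_rge0 // subr_ge0.
Qed.

Lemma enormD {R : realType} {n : nat} (u v : 'cV[R]_n) :
  enorm (u + v) <= enorm u + enorm v.
Proof.
rewrite -ler_sqr ?nnegrE ?addr_ge0 ?enorm_ge0 // sqrrD !sqr_enorm.
under eq_bigr => l _ do rewrite mxE sqrrD.
rewrite !big_split /= lerD2r lerD2l mulr2n.
by apply: lerD; exact: enorm_dot_le.
Qed.

Lemma sum_norm_ge0 {R : realType} {n m : nat} (a : 'M[R]_(n, m)) :
  0 <= sum_norm a.
Proof. by apply: sumr_ge0 => i _; exact: enorm_ge0. Qed.

Lemma sum_normN {R : realType} {n m : nat} (a : 'M[R]_(n, m)) :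
  sum_norm (- a) = sum_norm a.
Proof. by apply: eq_bigr => i _; rewrite linearN enormN. Qed.

Lemma sum_normD {R : realType} {n m : nat} (a b : 'M[R]_(n, m)) :
  sum_norm (a + b) <= sum_norm a + sum_norm b.
Proof.
by rewrite /sum_norm -big_split /=; apply: ler_sum => i _; rewrite linearD enormD.
Qed.

Lemma enorm_col_le {R : realType} {n m : nat} (a : 'M[R]_(n, m)) (i : 'I_m) :
  enorm (col i a) <= sum_norm a.
Proof.
rewrite /sum_norm (bigD1 i) //= lerDl.
by apply: sumr_ge0 => j _; exact: enorm_ge0.
Qed.

Lemma sum_sqr_enorm_le {R : realType} {n m : nat} (a : 'M[R]_(n, m)) :
  \sum_(i < m) enorm (col i a) ^+ 2 <= sum_norm a ^+ 2.
Proof.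
rewrite [leRHS]expr2 {1}/sum_norm mulr_suml; apply: ler_sum => i _.
by rewrite expr2 ler_wpM2l ?enorm_ge0 ?enorm_col_le.
Qed.

Lemma min_dist_le {R : realType} {n k : nat} (u : 'cV[R]_n)
    (x : 'M[R]_(n, k)) (j : 'I_k) :
  inf [set enorm (u - col j' x) ^+ 2 | j' in [set: 'I_k]]%classic
    <= enorm (u - col j x) ^+ 2.
Proof.
have k0 : (0 < k)%N := leq_ltn_trans (leq0n j) (ltn_ord j).
by have [j0 [-> j0min]] := kmeans_min_attained u x k0.
Qed.

Lemma kmeans_obj_nearest {R : realType} {n m k : nat} (a : 'M[R]_(n, m))
    (x : 'M[R]_(n, k)) : (0 < k)%N ->
  exists s : 'I_m -> 'I_k, kmeans_obj x a
    = m%:R^-1 * \sum_(i < m) enorm (col i a - col (s i) x) ^+ 2.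
Proof.
move=> k0.
have /choice[s sP] := fun i => kmeans_min_attained (col i a) x k0.
by exists s; congr (_ * _); apply: eq_bigr => i _; have [] := sP i.
Qed.

Lemma kmeans_obj_le {R : realType} {n m k : nat} (a : 'M[R]_(n, m))
    (x : 'M[R]_(n, k)) (s : 'I_m -> 'I_k) :
  kmeans_obj x a
    <= m%:R^-1 * \sum_(i < m) enorm (col i a - col (s i) x) ^+ 2.
Proof.
rewrite ler_wpM2l ?invr_ge0 ?ler0n //.
by apply: ler_sum => i _; exact: min_dist_le.
Qed.

(** The sum of the squared distances to the assigned centers cannot exceed
    the sum obtained with all centers at the origin, so neither can any single
    term. *)
Lemma optimal_dist_le {R : realType} {n m k : nat} (a : 'M[R]_(n, m))
    (x : 'M[R]_(n, k)) (s : 'I_m -> 'I_k) (i : 'I_m) :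
  (forall y : 'M[R]_(n, k), kmeans_obj x a <= kmeans_obj y a) ->
  kmeans_obj x a
    = m%:R^-1 * \sum_(l < m) enorm (col l a - col (s l) x) ^+ 2 ->
  enorm (col i a - col (s i) x) <= sum_norm a.
Proof.
move=> xmin xs.
have m0 : (0 < m)%N := leq_ltn_trans (leq0n i) (ltn_ord i).
have := le_trans (xmin 0) (kmeans_obj_le a 0 s).
rewrite xs ler_pM2l ?invr_gt0 ?ltr0n // => le0.
rewrite -ler_sqr ?nnegrE ?enorm_ge0 ?sum_norm_ge0 //.
apply: le_trans (sum_sqr_enorm_le a).
under eq_bigr => l _ do rewrite -[col l a]subr0 -(col0 _ _ (s l)).
apply: le_trans le0; rewrite (bigD1 i) //= lerDl.
by apply: sumr_ge0 => l _; exact: sqr_ge0.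
Qed.

(** Keep the optimal centers [x] of [a'] and the assignment of points to them:
    if [d] is the distance of a point of [a'] to its center, moving the point
    by [e] costs at most [(d + e) ^+ 2 - d ^+ 2 = (2 * d + e) * e]. *)
Lemma opt_value_sub_le {R : realType} {n m k : nat} (a a' : 'M[R]_(n, m)) :
  (0 < k)%N ->
  opt_value k a - opt_value k a'
    <= m%:R^-1 * ((2 * sum_norm a' + sum_norm (a - a')) * sum_norm (a - a')).
Proof.
move=> k0.
have [x' [-> x'min]] := opt_value_attained a' k0.
have [x [-> xmin]] := opt_value_attained a k0.
have [s x's] := kmeans_obj_nearest a' x' k0.
have le_d i := optimal_dist_le _ _ _ i x'min x's.
rewrite lerBlDl x's -mulrDr.
apply: le_trans (xmin x') (le_trans (kmeans_obj_le a x' s) _).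
rewrite ler_wpM2l ?invr_ge0 ?ler0n //.
rewrite {2}/sum_norm mulr_sumr -big_split /=; apply: ler_sum => i _.
set d := enorm (col i a' - _); set e := enorm (col i (a - a')).
have d0 : 0 <= d := enorm_ge0 _.
have e0 : 0 <= e := enorm_ge0 _.
have de : enorm (col i a - col (s i) x') <= d + e.
  rewrite [leRHS]addrC; have -> : col i a - col (s i) x' =
      col i (a - a') + (col i a' - col (s i) x').
    by rewrite linearB addrA subrK.
  exact: enormD.
have e_le : e <= sum_norm (a - a') := enorm_col_le _ i.
have d_le : d <= sum_norm a' := le_d i.
apply: (@le_trans _ _ ((d + e) ^+ 2)).
  by rewrite ler_sqr ?nnegrE ?enorm_ge0 ?addr_ge0.
have -> : (d + e) ^+ 2 = d ^+ 2 + (2 * d + e) * e by ring.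
by rewrite lerD2l ler_wpM2r // lerD // ler_pM2l.
Qed.

Theorem theorem5 (R : realType) (n m k : nat)
    (n_gt0 : (0 < n)%N) (m_gt0 : (0 < m)%N) (k_gt0 : (0 < k)%N)
    (k_le_m : (k <= m)%N)
    (abar : 'M[R]_(n, m))
    (abar_distinct : injective (fun i : 'I_m => col i abar)) :
  exists L0 delta0 : R, 0 < L0 /\ 0 < delta0 /\
    forall a a' : 'M[R]_(n, m),
      sum_norm (a - abar) < delta0 -> sum_norm (a' - abar) < delta0 ->
      `|opt_value k a - opt_value k a'| <= L0 * sum_norm (a - a').
Proof.
have S0 := sum_norm_ge0 abar.
exists (2 * sum_norm abar + 4), 1; split; first by lra.
split => // a a' a1 a'1.
have norm_le b : sum_norm (b - abar) < 1 -> sum_norm b <= sum_norm abar + 1.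
  by move=> b1; have := sum_normD (b - abar) abar; rewrite subrK; lra.
have dist_le : sum_norm (a - a') <= 2.
  have := sum_normD (a - abar) (- (a' - abar)).
  by rewrite sum_normN opprB addrA subrK; lra.
have m1 : (m%:R^-1 : R) <= 1 by rewrite invf_le1 ?ltr0n // ler1n.
have bound b b' : sum_norm (b' - abar) < 1 -> sum_norm (b - b') <= 2 ->
    opt_value k b - opt_value k b'
      <= (2 * sum_norm abar + 4) * sum_norm (b - b').
  move=> /norm_le le_b' le_bb'.
  apply: le_trans (opt_value_sub_le b b' k_gt0) _.
  have b'0 := sum_norm_ge0 b'; have bb'0 := sum_norm_ge0 (b - b').
  apply: (@le_trans _ _
    ((2 * sum_norm b' + sum_norm (b - b')) * sum_norm (b - b'))).
    by rewrite ler_piMl // mulr_ge0 //; lra.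
  by rewrite ler_wpM2r //; lra.
have distC : sum_norm (a' - a) = sum_norm (a - a') by rewrite -sum_normN opprB.
rewrite ler_norml lerNl opprB bound // andbT.
by rewrite -distC bound // distC.
Qed.
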